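(* Let $r$ be a positive integer, $k\in\mathbb Z$, and $a_1,\dots,a_r$ nonzero complex numbers. Then for every integer $n\ge0$, $$S_n^{(r,k)}(x|a_1,\dots,a_r)=\sum_{m=0}^n\left(\sum_{l=m}^nS_2(l,m)\binom{n}{l}S_{n-l}^{(r,k)}(-m|a_1,\dots,a_r)\right)(x)^{(m)},$$ where $(x)^{(m)}=x(x+1)\cdots(x+m-1)$ for $m\ge1$ and $(x)^{(0)}=1$.
   Context: For an integer $k$, ${\rm Li}_k(x)=\sum_{m=1}^\infty x^m/m^k$. For $r\in\mathbb Z_{>0}$, $k\in\mathbb Z$ and nonzero complex $a_1,\dots,a_r$, the polynomials $S_n^{(r,k)}(x|a_1,\dots,a_r)$ are defined by $\frac{t^r}{\prod_{j=1}^r(e^{a_jt}-1)}\frac{{\rm Li}_k(1-e^{-t})}{1-e^{-t}}e^{xt}=\sum_{n\ge0}S_n^{(r,k)}(x|a_1,\dots,a_r)\frac{t^n}{n!}$. $S_2(l,m)$ are the Stirling numbers of the second kind: $(e^t-1)^m=m!\sum_{l\ge m}S_2(l,m)\frac{t^l}{l!}$. *)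

(* Defs.v *)
From HB Require Import structures.
From mathcomp Require Import all_boot all_order all_algebra.
From mathcomp Require Import boolp classical_sets.
From mathcomp Require Export complex reals.

Set Implicit Arguments.
Unset Strict Implicit.
Unset Printing Implicit Defensive.

Import GRing.Theory Num.Theory.

Local Open Scope ring_scope.

(* Formal power series in t: Fps f stands for \sum_n f n * t ^ n. *)
Record fps (R : Type) := Fps { fpscoef : nat -> R }.

Arguments Fps {R}.

Notation "f ..[ n ]" := (fpscoef f n)
  (at level 2, left associativity, format "f ..[ n ]") : ring_scope.

HB.instance Definition _ (R : Type) := gen_eqMixin (fps R).
HB.instance Definition _ (R : Type) := gen_choiceMixin (fps R).

Lemma fpsP (R : Type) (f g : fps R) : (forall n, f..[n] = g..[n]) <-> f = g.
Proof.
split=> [|->//]; case: f g => [f] [g] /= fg; congr Fps.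
exact/funext.
Qed.

Section Ring.
Variable R : comNzRingType.
Implicit Types f g h : fps R.

Definition fps_zero : fps R := Fps (fun=> 0).
Definition fps_opp f : fps R := Fps (fun n => - f..[n]).
Definition fps_add f g : fps R := Fps (fun n => f..[n] + g..[n]).
Definition fps_one : fps R := Fps (fun n => (n == 0%N)%:R).
Definition fps_mul f g : fps R :=
  Fps (fun n => \sum_(i < n.+1) f..[i] * g..[n - i]).

Fact fps_addA : associative fps_add.
Proof. by move=> f g h; apply/fpsP => n /=; rewrite addrA. Qed.
Fact fps_addC : commutative fps_add.
Proof. by move=> f g; apply/fpsP => n /=; rewrite addrC. Qed.
Fact fps_add0 : left_id fps_zero fps_add.
Proof. by move=> f; apply/fpsP => n /=; rewrite add0r. Qed.
Fact fps_addN : left_inverse fps_zero fps_opp fps_add.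
Proof. by move=> f; apply/fpsP => n /=; rewrite addNr. Qed.

HB.instance Definition _ :=
  GRing.isZmodule.Build (fps R) fps_addA fps_addC fps_add0 fps_addN.

Let tr n f : {poly R} := \poly_(i < n.+1) f..[i].

Let tr_mul n (p q : {poly R}) f g :
  (forall i, (i <= n)%N -> p`_i = f..[i]) ->
  (forall i, (i <= n)%N -> q`_i = g..[i]) ->
  forall i, (i <= n)%N -> (p * q)`_i = (fps_mul f g)..[i].
Proof.
move=> pf qg i le_in; rewrite coefM /=; apply: eq_bigr => j _.
have le_ji : (j <= i)%N by rewrite -ltnS.
by rewrite pf ?qg // (leq_trans _ le_in) ?leq_subr.
Qed.

Let trE n f i : (i <= n)%N -> (tr n f)`_i = f..[i].
Proof. by move=> le_in; rewrite coef_poly ltnS le_in. Qed.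

Fact fps_mulA : associative fps_mul.
Proof.
move=> f g h; apply/fpsP => n.
have trn (e : fps R) i : (i <= n)%N -> (tr n e)`_i = e..[i] by apply: trE.
have := tr_mul (trn f) (tr_mul (trn g) (trn h)) (leqnn n).
by rewrite mulrA (tr_mul (tr_mul (trn f) (trn g)) (trn h) (leqnn n)).
Qed.
Fact fps_mulC : commutative fps_mul.
Proof.
move=> f g; apply/fpsP => n.
have trn (e : fps R) i : (i <= n)%N -> (tr n e)`_i = e..[i] by apply: trE.
have := tr_mul (trn f) (trn g) (leqnn n).
by rewrite mulrC (tr_mul (trn g) (trn f) (leqnn n)).
Qed.
Fact fps_mul1 : left_id fps_one fps_mul.
Proof.
move=> f; apply/fpsP => n /=; rewrite big_ord_recl big1 ?addr0 ?mul1r ?subn0 //.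
by move=> i _; rewrite mul0r.
Qed.
Fact fps_mulD : left_distributive fps_mul fps_add.
Proof.
move=> f g h; apply/fpsP => n /=; rewrite -big_split.
by apply: eq_bigr => i _; rewrite mulrDl.
Qed.
Fact fps_one_neq0 : fps_one != 0.
Proof.
by apply/eqP => /fpsP/(_ 0) /= /eqP; rewrite (negPf (oner_neq0 R)).
Qed.

HB.instance Definition _ := GRing.Zmodule_isComNzRing.Build (fps R)
  fps_mulA fps_mulC fps_mul1 fps_mulD fps_one_neq0.

Lemma fps0E n : (0 : fps R)..[n] = 0. Proof. by []. Qed.
Lemma fps1E n : (1 : fps R)..[n] = (n == 0%N)%:R. Proof. by []. Qed.
Lemma fpsDE f g n : (f + g)..[n] = f..[n] + g..[n]. Proof. by []. Qed.
Lemma fpsNE f n : (- f)..[n] = - f..[n]. Proof. by []. Qed.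
Lemma fpsBE f g n : (f - g)..[n] = f..[n] - g..[n]. Proof. by []. Qed.
Lemma fpsME f g n : (f * g)..[n] = \sum_(i < n.+1) f..[i] * g..[n - i].
Proof. by []. Qed.

Lemma fps_sumE (I : Type) (r : seq I) (P : pred I) (F : I -> fps R) n :
  (\sum_(i <- r | P i) F i)..[n] = \sum_(i <- r | P i) (F i)..[n].
Proof. exact: (big_morph (fun f => f..[n])). Qed.

Definition fpsC (c : R) : fps R := Fps (fun n => if n == 0%N then c else 0).

Lemma fpsCM c f n : (fpsC c * f)..[n] = c * f..[n].
Proof.
rewrite fpsME big_ord_recl big1 ?addr0 ?subn0 //.
by move=> i _; rewrite mul0r.
Qed.

Definition fpsX : fps R := Fps (fun n => (n == 1%N)%:R).

Lemma fpsXM f n : (fpsX * f)..[n] = if n is n'.+1 then f..[n'] else 0.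
Proof.
rewrite fpsME; case: n => [|n]; first by rewrite big_ord1 mul0r.
rewrite big_ord_recl mul0r add0r big_ord_recl mul1r /= subSS subn0 big1 ?addr0 //.
by move=> i _; rewrite mul0r.
Qed.

Lemma fpsX_fact f : f..[0] = 0 -> f = fpsX * Fps (fun n => f..[n.+1]).
Proof. by move=> f0; apply/fpsP => -[|n]; rewrite fpsXM. Qed.

Lemma fpsX_neq0 : fpsX != 0.
Proof. by apply/eqP => /fpsP/(_ 1) /eqP; rewrite /= oner_eq0. Qed.

Lemma fps_pow_low f m n : f..[0] = 0 -> (n < m)%N -> (f ^+ m)..[n] = 0.
Proof.
move=> /fpsX_fact ->; rewrite exprMn; move: (_ ^+ m in X in _ * X) => g.
elim: m n => // m IHm [|n]; rewrite exprS -mulrA fpsXM //.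
exact: IHm.
Qed.

(* f (g (t)); only meaningful when g has no constant term: then g ^+ i starts
   at t ^ i, so the sum below is the whole t ^ n coefficient of
   \sum_i f_i * g ^+ i. *)
Definition fps_comp f g : fps R :=
  Fps (fun n => \sum_(i < n.+1) f..[i] * (g ^+ i)..[n]).

Lemma fps_compE f g N n : g..[0] = 0 -> (n < N)%N ->
  (fps_comp f g)..[n] = \sum_(i < N) f..[i] * (g ^+ i)..[n].
Proof.
move=> g0 ltnN /=; rewrite (big_ord_widen N (fun i => f..[i] * (g ^+ i)..[n])) //.
rewrite [RHS](bigID (fun i : 'I_N => i < n.+1)%N) /= [X in _ + X]big1 ?addr0 //.
by move=> i; rewrite -leqNgt => lt_ni; rewrite fps_pow_low ?mulr0.
Qed.

End Ring.

Section UnitRing.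
Variable R : comUnitRingType.
Implicit Types f g : fps R.

Definition fps_unit : pred (fps R) := fun f => f..[0] \is a GRing.unit.

Definition fps_inv f : fps R :=
  if fps_unit f then
    fpsC (f..[0])^-1 * fps_comp (Fps (fun=> 1)) (1 - fpsC (f..[0])^-1 * f)
  else f.

Fact fps_mulV : {in fps_unit, left_inverse 1 fps_inv *%R}.
Proof.
move=> f Uf; rewrite /fps_inv -topredE /= in Uf *; rewrite Uf.
rewrite mulrAC; set u := fpsC _ * f; set h := 1 - u.
have h0 : h..[0] = 0 by rewrite fpsBE fpsCM mulVr // subrr.
apply/fpsP => n; rewrite fpsME.
have -> : \sum_(i < n.+1) u..[i] * (fps_comp (Fps (fun=> 1)) h)..[n - i]
   = (u * \sum_(j < n.+1) h ^+ j)..[n].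
  rewrite fpsME; apply: eq_bigr => i _; congr (_ * _).
  rewrite (fps_compE _ h0 (_ : n - i < n.+1)%N) ?ltnS ?leq_subr // fps_sumE.
  by apply: eq_bigr => j _; rewrite mul1r.
have -> : u = 1 - h by rewrite /h opprB addrCA subrr addr0.
by rewrite -[1 - h]opprB mulNr -subrX1 opprB fpsBE fps_pow_low // subr0.
Qed.

Fact fps_unitPl f g : g * f = 1 -> fps_unit f.
Proof.
move=> /fpsP/(_ 0); rewrite fpsME big_ord1 subnn fps1E => gf1.
by apply/unitrPr; exists g..[0]; rewrite mulrC.
Qed.

Fact fps_inv_out : {in [predC fps_unit], fps_inv =1 id}.
Proof. by move=> f /= /negPf Uf; rewrite /fps_inv [fps_unit f]Uf. Qed.

HB.instance Definition _ := GRing.ComNzRing_hasMulInverse.Build (fps R)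
  fps_mulV fps_unitPl fps_inv_out.

End UnitRing.

Section Domain.
Variable R : idomainType.

Fact fps_integral : GRing.integral_domain_axiom (fps R).
Proof.
move=> f g fg0; apply/norP => -[nzf nzg].
have low (h : fps R) : h != 0 ->
    exists2 n, h..[n] != 0 & forall i, (i < n)%N -> h..[i] = 0.
  move=> nzh; have exn : exists n, h..[n] != 0.
    by apply: contrapT => /forallNP h0; case/eqP: nzh; apply/fpsP => n;
      apply/eqP; move: (h0 n) => /negP; rewrite negbK.
  case: (ex_minnP exn) => n hn hmin; exists n => // i.
  by apply: contraTeq => /hmin; rewrite -leqNgt.
have [m fm flow] := low f nzf; have [n gn glow] := low g nzg.
move/fpsP: fg0 => /(_ (m + n)) /eqP; rewrite fpsME fps0E.
have lt_m : (m < (m + n).+1)%N by rewrite ltnS leq_addr.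
rewrite (bigD1 (Ordinal lt_m)) //= addKn big1 ?addr0 ?mulf_eq0 ?(negPf fm) ?(negPf gn) //.
move=> i; rewrite -val_eqE /= => ne_im.
have [lt_im|le_mi] := ltnP i m; first by rewrite flow ?mul0r.
have lt_mi : (m < i)%N by rewrite ltn_neqAle eq_sym ne_im.
by rewrite glow ?mulr0 // ltn_subLR ?ltn_add2r // -ltnS.
Qed.

HB.instance Definition _ :=
  GRing.ComUnitRing_isIntegral.Build (fps R) fps_integral.

(* e ^ (c * t) *)
Definition fps_exp (c : R) : fps R := Fps (fun n => c ^+ n / n`!%:R).

(* \sum_n s_n * t ^ n / n! *)
Definition fps_egf (s : nat -> R) : fps R := Fps (fun n => s n / n`!%:R).

Definition fps_Li (k : int) : fps R :=
  Fps (fun m => if m == 0%N then 0 else (m%:R : R) ^ (- k)).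

End Domain.

Arguments fpsX {R}.
Arguments fps_Li {R}.

Section Polynomials.
Variable C : numFieldType.

(* The field of fractions gives a meaning to the quotients below, whose
   denominators are not invertible as power series. The coefficients are
   polynomials in the variable x = 'X. *)
Local Notation "f %:F" := (@FracField.tofrac (fps {poly C}) f).

Definition S_genfun (r : nat) (k : int) (a : 'I_r -> C) :
    {fraction fps {poly C}} :=
  fpsX%:F ^+ r / \prod_(j < r) (fps_exp (a j)%:P - 1)%:F
  * ((fps_comp (fps_Li k) (1 - fps_exp (- 1)))%:F / (1 - fps_exp (- 1))%:F)
  * (fps_exp 'X)%:F.

(* The sequence with exponential generating function S_genfun k a; by S_poly_egf
   and S_poly_unique it exists and is unique when all a_j are nonzero. *)
Definition S_poly (r : nat) (k : int) (a : 'I_r -> C) : nat -> {poly C} :=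
  xget (fun=> 0) [set s | S_genfun k a = (fps_egf s)%:F].

Let fact_unit n : (n`!%:R : {poly C}) \is a GRing.unit.
Proof.
by rewrite -polyC_natr poly_unitE size_polyC coefC pnatr_eq0 -lt0n fact_gt0
  unitfE pnatr_eq0 -lt0n fact_gt0.
Qed.

Lemma S_poly_egf (r : nat) (k : int) (a : 'I_r -> C) :
  (forall j, a j != 0) -> S_genfun k a = (fps_egf (S_poly k a))%:F.
Proof.
move=> nza; suff [G GE] : exists G, S_genfun k a = G%:F.
  apply: (@xgetPex _ (fun=> 0) [set s | S_genfun k a = (fps_egf s)%:F]).
  exists (fun n => G..[n] * n`!%:R) => /=; rewrite GE; congr _%:F.
  by apply/fpsP => n /=; rewrite mulrK.
pose sh (f : fps {poly C}) := Fps (fun n => f..[n.+1]).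
have shV f : f..[0] = 0 -> f%:F = fpsX%:F * (sh f)%:F.
  by move=> f0; rewrite -tofracM -fpsX_fact.
have nzX : fpsX%:F != 0 by rewrite tofrac_eq0 fpsX_neq0.
pose u j := sh (fps_exp (a j)%:P - 1); pose v := sh (1 - fps_exp (- 1)).
have Uu j : u j \is a GRing.unit.
  rewrite -topredE /= /fps_unit /= subr0 divr1 expr1.
  by rewrite poly_unitE size_polyC nza coefC unitfE nza.
have Uv : v \is a GRing.unit.
  by rewrite -topredE /= /fps_unit /= sub0r divr1 expr1 opprK unitr1.
exists (\prod_j (u j)^-1 * (sh (fps_comp (fps_Li k) (1 - fps_exp (- 1))) / v)
        * fps_exp 'X).
rewrite !tofracM (rmorph_prod (@FracField.tofrac _)) /=; congr (_ * _ * _).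
- have -> : \prod_j (fps_exp (a j)%:P - 1)%:F = fpsX%:F ^+ r * \prod_j (u j)%:F.
    rewrite -[in X in _ ^+ X](card_ord r) -prodr_const -big_split /=.
    by apply: eq_bigr => j _; rewrite shV //= divr1 expr0 subrr.
  rewrite invfM mulrA divff ?expf_neq0 // mul1r -prodfV.
  by apply: eq_bigr => j _; rewrite rmorphV.
rewrite [X in X / _]shV; last by rewrite /= big_ord1 mul0r.
rewrite [X in _ / X]shV; last by rewrite /= divr1 expr0 subrr.
by rewrite invfM mulrACA divff // mul1r rmorphV.
Qed.

Lemma S_poly_unique (r : nat) (k : int) (a : 'I_r -> C) (s : nat -> {poly C}) :
  S_genfun k a = (fps_egf s)%:F -> S_poly k a = s.
Proof.
move=> sE; apply: xget_unique => // s'; rewrite /= sE => /eqP.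
rewrite tofrac_eq => /eqP/fpsP ss'; apply/funext => n.
by have := ss' n; rewrite /= => /(mulIr _)->; rewrite ?unitrV.
Qed.

(* (e ^ t - 1) ^ m = m! * \sum_l (stirling2 l m) * t ^ l / l! *)
Definition stirling2 (l m : nat) : C :=
  l`!%:R / m`!%:R * ((fps_exp (1 : C) - 1) ^+ m)..[l].

Let nzfact n : (n`!%:R : C) != 0.
Proof. by rewrite pnatr_eq0 -lt0n fact_gt0. Qed.

Lemma stirling2_egf (m : nat) :
  (fps_exp (1 : C) - 1) ^+ m = fpsC m`!%:R * fps_egf (stirling2^~ m).
Proof.
apply/fpsP => l; rewrite fpsCM /= /stirling2 mulrAC [X in _ * (X * _)]mulrAC.
by rewrite divff // mul1r mulrA divff // mul1r.
Qed.

Lemma stirling2_small (l m : nat) : (l < m)%N -> stirling2 l m = 0.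
Proof.
by move=> lt_lm; rewrite /stirling2 fps_pow_low ?mulr0 //= divr1 expr0 subrr.
Qed.

Definition rising_factorial (m : nat) : {poly C} :=
  \prod_(i < m) ('X + i%:R%:P).

End Polynomials.

(* Main.v *)
Require Import Defs.
From HB Require Import structures.
From mathcomp Require Import all_boot all_order all_algebra.
From mathcomp Require Import reals complex.
From mathcomp Require Import ring.

(* Both sides are polynomials in x, so it suffices to compare them at x = - j
   for all natural j.  The generating function at x is G(t) e^(xt) with G
   independent of x, and S_n(- m) occurs in the sum through
   (e^t - 1)^m G e^(- mt) = (1 - e^(- t))^m G.  As the rising factorial at - j
   is (- 1)^m m! C(j, m), the sum is the binomial expansion of
   e^(- jt) G = (1 - (1 - e^(- t)))^j G. *)

Import GRing.Theory Num.Theory.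

Local Open Scope ring_scope.

(** With [phi] the evaluation at a point, this specialises the variable x in series over
    [{poly C}]. *)
Definition fps_map (R S : Type) (phi : R -> S) (f : fps R) : fps S :=
  Fps (fun n => phi f..[n]).

Arguments fps_map {R S}.

Section FpsMap.
Variables (R S : comNzRingType) (phi : {rmorphism R -> S}).

Fact fps_map_is_zmod_morphism : zmod_morphism (fps_map phi).
Proof. by move=> f g; apply/fpsP => n /=; rewrite rmorphB. Qed.

Fact fps_map_is_monoid_morphism : monoid_morphism (fps_map phi).
Proof.
split=> [|f g]; apply/fpsP => n /=; first by rewrite rmorph_nat.
by rewrite rmorph_sum; apply: eq_bigr => i _; rewrite rmorphM.
Qed.

HB.instance Definition _ := GRing.isZmodMorphism.Build (fps R) (fps S)
  (fps_map phi) fps_map_is_zmod_morphism.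
HB.instance Definition _ := GRing.isMonoidMorphism.Build (fps R) (fps S)
  (fps_map phi) fps_map_is_monoid_morphism.

Lemma fps_map_comp (f g : fps R) :
  fps_map phi (fps_comp f g) = fps_comp (fps_map phi f) (fps_map phi g).
Proof.
apply/fpsP => n; rewrite /= rmorph_sum; apply: eq_bigr => i _.
by rewrite rmorphM -rmorphXn.
Qed.

Lemma fps_mapX : fps_map phi fpsX = fpsX.
Proof. by apply/fpsP => n /=; rewrite rmorph_nat. Qed.

End FpsMap.

Lemma fpsMnE (R : comNzRingType) (f : fps R) m n : (f *+ m)..[n] = f..[n] *+ m.
Proof. by elim: m => [|m IHm] //; rewrite !mulrS fpsDE IHm. Qed.

Lemma fps_signM (R : comNzRingType) (f : fps R) m n :
  ((-1) ^+ m * f)..[n] = (-1) ^+ m * f..[n].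
Proof.
by rewrite -signr_odd -[in RHS]signr_odd; case: odd; rewrite ?mulN1r ?mul1r.
Qed.

Section FpsMapQ.
Variables (R S : idomainType) (phi : {rmorphism R -> S}).
(** A ring morphism respects division by units only, and [{poly C}], the intended [R], is not a
    field; the factorials and the powers in [fps_Li] must therefore be invertible. *)
Hypothesis natU : forall n, n.+1%:R \is a @GRing.unit R.

Let factU n : n`!%:R \is a @GRing.unit R.
Proof. by rewrite -(prednK (fact_gt0 n)). Qed.

Lemma fps_map_egf (s : nat -> R) :
  fps_map phi (fps_egf s) = fps_egf (phi \o s).
Proof. by apply/fpsP => n /=; rewrite rmorph_div // rmorph_nat. Qed.

Lemma fps_map_exp (c : R) : fps_map phi (fps_exp c) = fps_exp (phi c).
Proof. by apply/fpsP => n /=; rewrite rmorph_div // rmorph_nat rmorphXn. Qed.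

Lemma fps_map_Li (k : int) : fps_map phi (fps_Li k) = fps_Li k.
Proof.
apply/fpsP => -[|n] /=; first by rewrite rmorph0.
by rewrite rmorphXz // rmorph_nat.
Qed.

End FpsMapQ.

(** The coefficient of t is [c]. This makes the denominators cancellable, although they are not
    invertible as series. *)
Lemma fps_exp_neq1 (R : idomainType) (c : R) : c != 0 -> fps_exp c - 1 != 0.
Proof.
apply: contraNneq => /fpsP/(_ 1%N).
by rewrite fpsBE fps1E fps0E subr0 /= divr1 expr1 => ->.
Qed.

Section NumField.
Variable C : numFieldType.

Lemma natfact_neq0 n : n`!%:R != 0 :> C.
Proof. by rewrite pnatr_eq0 -lt0n fact_gt0. Qed.

Lemma polyC_natU n : n.+1%:R \is a @GRing.unit {poly C}.
Proof. by rewrite -polyC_natr rmorph_unit // unitfE pnatr_eq0. Qed.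

Lemma fps_egfM (s s' : nat -> C) :
  fps_egf s * fps_egf s' =
  fps_egf (fun n => \sum_(l < n.+1) 'C(n, l)%:R * s l * s' (n - l)%N).
Proof.
apply/fpsP => n /=; rewrite mulr_suml; apply: eq_bigr => l _.
have le_ln : (l <= n)%N by rewrite -ltnS.
rewrite -(bin_fact le_ln) !natrM.
have nzb : 'C(n, l)%:R != 0 :> C by rewrite pnatr_eq0 -lt0n bin_gt0.
by field; rewrite nzb !natfact_neq0.
Qed.

Lemma fps_expD (c d : C) : fps_exp (c + d) = fps_exp c * fps_exp d.
Proof.
(* [fps_exp c] is by definition the exponential generating function of the powers of [c], so the
   claim becomes the binomial theorem. *)
rewrite [RHS](fps_egfM (GRing.exp c) (GRing.exp d)).
apply/fpsP => n /=; congr (_ / _); rewrite addrC exprDn.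
by apply: eq_bigr => i _; rewrite -mulr_natl mulrA mulrAC mulrC mulrA.
Qed.

Lemma fps_exp0 : fps_exp 0 = 1 :> fps C.
Proof. by apply/fpsP => -[|n]; rewrite /= ?divr1 // exprS !mul0r. Qed.

Lemma fps_expMn (c : C) n : fps_exp (c *+ n) = fps_exp c ^+ n.
Proof.
elim: n => [|n IHn]; first by rewrite fps_exp0.
by rewrite mulrS fps_expD IHn exprS.
Qed.

Lemma horner_rising_factorial m j :
  (rising_factorial C m).[- j%:R] = (-1) ^+ m * m`!%:R * 'C(j, m)%:R.
Proof.
rewrite -mulrA -natrM mulnC bin_ffact /rising_factorial horner_prod.
elim: m => [|m IHm]; first by rewrite big_ord0 mul1r.
rewrite big_ord_recr /= IHm !hornerE.
(* The recursion multiplies by the truncated difference [j - m], which is the true one only for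
   [m <= j]; otherwise both falling factorials vanish. *)
have [lt_jm|le_mj] := ltnP j m; first by rewrite !ffact_small ?mulr0 ?mul0r // ltnW.
by rewrite ffactnSr natrM natrB // exprS; ring.
Qed.

(** In characteristic zero the points [- j%:R] are distinct, so [p - q] has more roots than a
    nonzero polynomial of its size can have. *)
Lemma poly_eq_at_negn (p q : {poly C}) :
  (forall j : nat, p.[- j%:R] = q.[- j%:R]) -> p = q.
Proof.
move=> pq; apply/eqP; rewrite -subr_eq0; apply/eqP.
apply: (@roots_geq_poly_eq0 _ _ [seq - i%:R | i <- iota 0 (size (p - q))]).
- by apply/allP => _ /mapP[i _ ->]; rewrite rootE !hornerE pq subrr.
- rewrite map_inj_uniq ?iota_uniq // => i j /oppr_inj/eqP.
  by rewrite eqr_nat => /eqP.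
- by rewrite size_map size_iota.
Qed.

Section SPoly.
Variables (r : nat) (k : int) (a : 'I_r -> C).
Hypothesis nza : forall j, a j != 0.

Definition S_egf (x : C) : fps C := fps_egf (fun n => (S_poly k a n).[x]).

(* Denominators are cleared before specialising x, because evaluation at a
   point does not extend to the fraction field. *)
Lemma S_egf_clear (x : C) :
  fpsX ^+ r * fps_comp (fps_Li k) (1 - fps_exp (- 1)) * fps_exp x =
  S_egf x * (\prod_(j < r) (fps_exp (a j) - 1) * (1 - fps_exp (- 1))).
Proof.
have clear : fpsX ^+ r * fps_comp (fps_Li k) (1 - fps_exp (- 1)) * fps_exp 'X =
    fps_egf (S_poly k a) *
    (\prod_(j < r) (fps_exp (a j)%:P - 1) * (1 - fps_exp (- 1))).
  (* The embedding into the fraction field is injective, so the cleared identity may be checked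
     there. *)
  apply/eqP; rewrite -tofrac_eq !tofracM -S_poly_egf // /S_genfun.
  rewrite (rmorph_prod (@FracField.tofrac _)) tofracXn /=.
  set P := \prod_(j < r) _; set V := FracField.tofrac (1 - _).
  have nzP : P != 0.
    by apply/prodf_neq0 => j _; rewrite tofrac_eq0 fps_exp_neq1 // polyC_eq0.
  have nzV : V != 0.
    by rewrite tofrac_eq0 -opprB oppr_eq0 fps_exp_neq1 // oppr_eq0 oner_eq0.
  by rewrite [X in _ == X * _ * _]mulrACA -invfM [eqbRHS]mulrAC divfK ?mulf_neq0.
have ev_exp p : fps_map (horner_eval x) (fps_exp p) = fps_exp p.[x].
  by apply: fps_map_exp; apply: polyC_natU.
have /(congr1 (fps_map (horner_eval x))) := clear.
rewrite !rmorphM rmorphXn rmorph_prod /= fps_mapX fps_map_comp rmorphB rmorph1 /=.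
rewrite fps_map_Li ?ev_exp; last exact: polyC_natU.
rewrite fps_map_egf ?hornerX ?hornerN ?hornerC; last exact: polyC_natU.
move=> ->; congr (_ * (_ * _)); apply: eq_bigr => j _.
by rewrite rmorphB rmorph1 /= ev_exp hornerC.
Qed.

(** In the cleared identity x enters only through [fps_exp x], and the nonzero denominator [D]
    cancels in the integral domain of series. *)
Lemma S_egf_shift (x : C) : S_egf x = S_egf 0 * fps_exp x.
Proof.
set D := \prod_(j < r) (fps_exp (a j) - 1) * (1 - fps_exp (- 1)).
have nzD : D != 0.
  rewrite mulf_neq0 //; first by apply/prodf_neq0 => j _; rewrite fps_exp_neq1.
  by rewrite -opprB oppr_eq0 fps_exp_neq1 // oppr_eq0 oner_eq0.
apply: (mulIf nzD); rewrite -S_egf_clear [RHS]mulrAC -S_egf_clear.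
by rewrite fps_exp0 mulr1.
Qed.

(** The inner sum is taken from [l = 0] to be a full binomial convolution, hence a product of
    exponential generating functions. *)
Lemma stirling_S_egf m :
  fps_egf (fun n => \sum_(l < n.+1)
    stirling2 C l m * 'C(n, l)%:R * (S_poly k a (n - l)).[- m%:R]) =
  fpsC m`!%:R^-1 * ((1 - fps_exp (- 1)) ^+ m * S_egf 0).
Proof.
have -> : (1 - fps_exp (- 1)) ^+ m =
    (fps_exp 1 - 1) ^+ m * fps_exp (- m%:R) :> fps C.
  rewrite -mulNrn fps_expMn -exprMn mulrBl mul1r -fps_expD subrr.
  by rewrite fps_exp0.
rewrite -mulrA [fps_exp _ * _]mulrC -S_egf_shift stirling2_egf -mulrA.
apply/fpsP => n; rewrite !fpsCM mulKf ?natfact_neq0 // fps_egfM /=.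
by congr (_ / _); apply: eq_bigr => l _; rewrite [_ * 'C(n, l)%:R]mulrC.
Qed.

Theorem S_poly_rising_factorial n :
  S_poly k a n =
  \sum_(0 <= m < n.+1)
    (\sum_(m <= l < n.+1)
       stirling2 C l m * 'C(n, l)%:R * (S_poly k a (n - l)).[- m%:R])
    *: rising_factorial C m.
Proof.
apply: poly_eq_at_negn => j.
pose u : fps C := 1 - fps_exp (- 1).
have u0 : u..[0] = 0 by rewrite fpsBE /= divr1 expr0 subrr.
(* The terms of the binomial expansion of [(1 - u) ^+ j * S_egf 0] at order n. They vanish for
   [m > n], as [u ^+ m] starts at order m, and for [m > j]. *)
pose T m := 'C(j, m)%:R * (-1) ^+ m * (u ^+ m * S_egf 0)..[n].
have T_n m : (n < m)%N -> T m = 0.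
  move=> lt_nm; rewrite /T fpsME big1 ?mulr0 // => i _.
  by rewrite fps_pow_low ?mul0r // (leq_ltn_trans _ lt_nm) // -ltnS.
have T_j m : (j < m)%N -> T m = 0 by move=> lt_jm; rewrite /T bin_small ?mul0r.
(* The theorem sums up to n and the binomial expansion up to j; both sums are compared over the
   larger range. *)
have T_trunc N M : (forall m, (N <= m)%N -> T m = 0) ->
    \sum_(0 <= m < N) T m = \sum_(0 <= m < maxn N M) T m.
  move=> T0; rewrite (big_cat_nat (leq0n N) (leq_maxl N M)) /=.
  by rewrite [X in _ + X]big_nat_cond [X in _ + X]big1 ?addr0 // => i /andP[/andP[/T0]].
have sE : (S_egf (- j%:R))..[n] = \sum_(0 <= m < n.+1) T m.
  rewrite (T_trunc _ j.+1) // maxnC -T_trunc // S_egf_shift -mulNrn fps_expMn.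
  have -> : fps_exp (- 1) = 1 - u by rewrite subKr.
  rewrite exprBn mulr_sumr fps_sumE big_mkord; apply: eq_bigr => m _.
  rewrite expr1n mulr1 mulrnAr fpsMnE mulrCA fps_signM.
  by rewrite -mulr_natl mulrA [S_egf 0 * _]mulrC.
have nzn := natfact_neq0 n.
have -> : (S_poly k a n).[- j%:R] = n`!%:R * (S_egf (- j%:R))..[n].
  by rewrite /= mulrCA divff ?mulr1.
rewrite sE mulr_sumr horner_sum; apply: eq_big_nat => m /andP[_ lt_mn].
rewrite hornerZ horner_rising_factorial.
(* The Stirling numbers with [l < m] are zero, so the sum may start at 0. *)
have -> : \sum_(m <= l < n.+1)
      stirling2 C l m * 'C(n, l)%:R * (S_poly k a (n - l)).[- m%:R] =
    \sum_(l < n.+1)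
      stirling2 C l m * 'C(n, l)%:R * (S_poly k a (n - l)).[- m%:R].
  rewrite -(big_mkord xpredT
    (fun l => stirling2 C l m * 'C(n, l)%:R * (S_poly k a (n - l)).[- m%:R])).
  rewrite [RHS](big_cat_nat (leq0n m) (ltnW lt_mn)) /= [X in X + _]big_nat_cond.
  rewrite [X in X + _]big1 ?add0r // => l /andP[/andP[_ lt_lm] _].
  by rewrite stirling2_small ?mul0r.
have /fpsP/(_ n) := stirling_S_egf m; rewrite fpsCM.
move/(canRL (divfK nzn)) ->.
have nzm := natfact_neq0 m.
by rewrite /T; field.
Qed.

End SPoly.

End NumField.

Theorem theorem7 (R : realType) (r : nat) (hr : (0 < r)%N) (k : int)
    (a : 'I_r -> R[i]) (ha : forall j, a j != 0) (n : nat) :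
  S_poly k a n =
  \sum_(0 <= m < n.+1)
    (\sum_(m <= l < n.+1)
       stirling2 R[i] l m * 'C(n, l)%:R * (S_poly k a (n - l)).[- m%:R])
    *: rising_factorial R[i] m.
Proof. exact: S_poly_rising_factorial. Qed.
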